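(* The double well potential problem $\min_{w\in\mathbb{R}^n} g(w)$ has a local non-global minimizer if and only if there is a $\underline{t}^*\in(\max\{2\nu-2\alpha_2,0\},\,2\nu-2\alpha_1)$ such that the secular function $h$ satisfies $h(\underline{t}^* )=0$ and $h'(\underline{t}^* )>0$. Moreover, when it exists, the local non-global minimizer is given by $$\underline{w}=\left(\frac{2\psi_1}{\underline{t}^*-2\nu+2\alpha_1},\ldots,\frac{2\psi_n}{\underline{t}^*-2\nu+2\alpha_n}\right).$$
   Context: Let $n\ge 1$ be an integer, $\nu\in\mathbb{R}$, $\psi=(\psi_1,\dots,\psi_n)^T\in\mathbb{R}^n$, and $D=\mathrm{Diag}(\alpha_1,\dots,\alpha_n)$ a real diagonal matrix with $\alpha_1\le\alpha_2\le\dots\le\alpha_n$. The double well potential function is $g:\mathbb{R}^n\to\mathbb{R}$, $$g(w)=\frac12\left(\frac12\|w\|^2-\nu\right)^2+\frac12 w^TDw-\psi^Tw,$$ where $\|\cdot\|$ is the Euclidean norm. A local non-global minimizer is a local minimizer of $g$ on $\mathbb{R}^n$ that is not a global minimizer of $g$. The secular function is $$h(t)=\sum_{i=1}^n\frac{4\psi_i^2}{(t-2\nu+2\alpha_i)^2}-t,\qquad t\in(\max\{2\nu-2\alpha_2,0\},\,2\nu-2\alpha_1),$$ where the interval is empty if its left endpoint is not smaller than its right endpoint. When $n=1$ we use the convention $\alpha_2=+\infty$, so that $\max\{2\nu-2\alpha_2,0\}=0$. *)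

(* Defs.v *)
From HB Require Import structures.
From mathcomp Require Import all_boot all_order all_algebra.
From mathcomp Require Import all_classical all_reals all_analysis.

Set Implicit Arguments.
Unset Strict Implicit.
Unset Printing Implicit Defensive.

Import Order.TTheory GRing.Theory Num.Theory.
Import numFieldNormedType.Exports.

Local Open Scope classical_set_scope.
Local Open Scope ring_scope.

(* The library norm `|w| on matrices is the sup norm, so the Euclidean norm is
   defined here.  Both induce the library's topology on 'cV[R]_n. *)
Definition enorm (R : realType) (n : nat) (w : 'cV[R]_n) : R :=
  Num.sqrt (\sum_(i < n) w i 0 ^+ 2).

Definition local_minimizer (R : realType) (n : nat)
    (f : 'cV[R]_n -> R) (w : 'cV[R]_n) : Prop :=
  \forall v \near w, f w <= f v.

Definition global_minimizer (R : realType) (n : nat)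
    (f : 'cV[R]_n -> R) (w : 'cV[R]_n) : Prop :=
  forall v, f w <= f v.

Definition local_nonglobal_minimizer (R : realType) (n : nat)
    (f : 'cV[R]_n -> R) (w : 'cV[R]_n) : Prop :=
  local_minimizer f w /\ ~ global_minimizer f w.

(* Indices start at 0: alpha 0 i, psi i 0 and w i 0 are the components numbered
   i + 1 in the usual notation, and the dimension is n.+1, hence at least 1. *)

Definition double_well (R : realType) (n : nat) (nu : R)
    (alpha : 'rV[R]_n.+1) (psi : 'cV[R]_n.+1) (w : 'cV[R]_n.+1) : R :=
  2^-1 * (2^-1 * enorm w ^+ 2 - nu) ^+ 2
  + 2^-1 * (w^T *m diag_mx alpha *m w) 0 0
  - (psi^T *m w) 0 0.

(* Meaningful on secular_interval, where no denominator vanishes. *)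
Definition secular (R : realType) (n : nat) (nu : R)
    (alpha : 'rV[R]_n.+1) (psi : 'cV[R]_n.+1) (t : R) : R :=
  \sum_(i < n.+1) 4 * psi i 0 ^+ 2 / (t - 2 * nu + 2 * alpha 0 i) ^+ 2 - t.

(* In dimension 1 there is no index 1, insub returns None and the bound is 0:
   this is the convention that the missing second diagonal entry is +oo. *)
Definition secular_left (R : realType) (n : nat) (nu : R)
    (alpha : 'rV[R]_n.+1) : R :=
  if (insub 1%N : option 'I_n.+1) is Some i
  then Num.max (2 * nu - 2 * alpha 0 i) 0 else 0.

Definition secular_interval (R : realType) (n : nat) (nu : R)
    (alpha : 'rV[R]_n.+1) : interval R :=
  `]secular_left nu alpha, 2 * nu - 2 * alpha 0 0[.

Definition secular_point (R : realType) (n : nat) (nu : R)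
    (alpha : 'rV[R]_n.+1) (psi : 'cV[R]_n.+1) (t : R) : 'cV[R]_n.+1 :=
  \col_i (2 * psi i 0 / (t - 2 * nu + 2 * alpha 0 i)).

(* Main.v *)
(* Write t = |w|^2 and mu_i = t/2 - nu + alpha_i.  If mu_i w_i = psi_i for all i
   then g(w+d) - g(w) = (sum_i mu_i d_i^2 + (w.d + |d|^2/2)^2) / 2 exactly, and
   everything is read off this identity.  If w is a local non-global
   minimizer, then mu_1 < 0, while well-chosen perturbations d force w_1 <> 0,
   mu_i > 0 for i >= 2 and sum_i w_i^2 / mu_i < -1, that is, h'(t) > 0.
   Conversely, since w.d + |d|^2/2 = (w + d/2).d, the increment is a quadratic
   form in d that is nonnegative as soon as the open condition
   sum_i v_i^2 / mu_i < -1 holds at v = w + d/2; and w is not a global minimizer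
   because flipping the sign of w_1 decreases g.  Convexity of h on the interval
   leaves room for only one root with h' > 0. *)

Require Import Defs.
From HB Require Import structures.
From mathcomp Require Import all_boot all_order all_algebra.
From mathcomp Require Import all_classical all_reals all_analysis.
From mathcomp Require Import ring lra.

Set Implicit Arguments.
Unset Strict Implicit.
Unset Printing Implicit Defensive.

Import Order.TTheory GRing.Theory Num.Theory.
Import numFieldNormedType.Exports.

Local Open Scope classical_set_scope.
Local Open Scope ring_scope.

(** * Exact increment of the double well function *)

Lemma enorm_sqr (R : realType) (n : nat) (w : 'cV[R]_n) :
  enorm w ^+ 2 = \sum_i w i 0 ^+ 2.
Proof. by rewrite sqr_sqrtr // sumr_ge0 // => i _; exact: sqr_ge0. Qed.

Lemma double_wellE (R : realType) (n : nat) (nu : R) (alpha : 'rV[R]_n.+1)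
    (psi w : 'cV[R]_n.+1) :
  double_well nu alpha psi w =
  2^-1 * (2^-1 * (\sum_i w i 0 ^+ 2) - nu) ^+ 2
  + 2^-1 * (\sum_i alpha 0 i * w i 0 ^+ 2) - \sum_i psi i 0 * w i 0.
Proof.
rewrite /double_well enorm_sqr; congr (_ + _ * _ - _); rewrite mxE.
  by apply: eq_bigr => i _; rewrite mul_mx_diag !mxE; ring.
by apply: eq_bigr => i _; rewrite mxE.
Qed.

(* Half the denominator of the secular function; at t = |w|^2 the gradient of
   the double well function at w is multiplier i * w i - psi i. *)
Definition multiplier (R : realType) (n : nat) (nu : R) (alpha : 'rV[R]_n.+1)
    (t : R) (i : 'I_n.+1) : R :=
  2^-1 * t - nu + alpha 0 i.

(** Moving from [w] to [w + d] adds w.d + |d|^2/2 to |w|^2/2 - nu. Expanding the outer square, the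
    cross term merges with the [alpha] part into the multipliers, and the square of the added amount
    is kept whole, so there is no Taylor remainder to estimate. *)
Lemma double_well_increment (R : realType) (n : nat) (nu : R)
    (alpha : 'rV[R]_n.+1) (psi w d : 'cV[R]_n.+1) :
  let mu := multiplier nu alpha (\sum_i w i 0 ^+ 2) in
  double_well nu alpha psi (w + d) - double_well nu alpha psi w =
  \sum_i (mu i * w i 0 - psi i 0) * d i 0
  + 2^-1 * (\sum_i mu i * d i 0 ^+ 2
            + (\sum_i w i 0 * d i 0 + 2^-1 * \sum_i d i 0 ^+ 2) ^+ 2).
Proof.
move=> mu; rewrite !double_wellE.
set t := \sum_i w i 0 ^+ 2 in mu *.
have -> : \sum_i (w + d) i 0 ^+ 2 =
    t + 2 * (\sum_i w i 0 * d i 0) + \sum_i d i 0 ^+ 2.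
  rewrite mulr_sumr -!big_split; apply: eq_bigr => i _ /=; rewrite !mxE; ring.
have -> : \sum_i alpha 0 i * (w + d) i 0 ^+ 2 =
    \sum_i alpha 0 i * w i 0 ^+ 2 + 2 * (\sum_i alpha 0 i * w i 0 * d i 0)
    + \sum_i alpha 0 i * d i 0 ^+ 2.
  rewrite mulr_sumr -!big_split; apply: eq_bigr => i _ /=; rewrite !mxE; ring.
have -> : \sum_i psi i 0 * (w + d) i 0 =
    \sum_i psi i 0 * w i 0 + \sum_i psi i 0 * d i 0.
  by rewrite -!big_split; apply: eq_bigr => i _ /=; rewrite !mxE; ring.
have -> : \sum_i mu i * d i 0 ^+ 2 =
    (2^-1 * t - nu) * (\sum_i d i 0 ^+ 2) + \sum_i alpha 0 i * d i 0 ^+ 2.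
  rewrite mulr_sumr -!big_split; apply: eq_bigr => i _ /=.
  rewrite /mu /multiplier; ring.
have -> : \sum_i (mu i * w i 0 - psi i 0) * d i 0 =
    (2^-1 * t - nu) * (\sum_i w i 0 * d i 0)
    + \sum_i alpha 0 i * w i 0 * d i 0 - \sum_i psi i 0 * d i 0.
  rewrite mulr_sumr -sumrN -!big_split; apply: eq_bigr => i _ /=.
  rewrite /mu /multiplier; ring.
by field.
Qed.

(** * Necessary conditions at a local minimizer *)

Lemma local_minimizer_ball (R : realType) (n : nat) (f : 'cV[R]_n.+1 -> R)
    (w : 'cV[R]_n.+1) :
  local_minimizer f w ->
  exists2 e : R, 0 < e & forall d, `|d| < e -> f w <= f (w + d).
Proof.
move=> /nbhs_normP[e /= e0 he]; exists e => // d hd.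
by apply: he => /=; rewrite opprD addrA subrr sub0r normrN.
Qed.

(** One sufficiently short step along [q] is enough for every contradiction below; [b] lets the
    caller impose its own smallness condition on that step. *)
Lemma local_minimizer_ray (R : realType) (n : nat) (f : 'cV[R]_n.+1 -> R)
    (w q : 'cV[R]_n.+1) (b : R) :
  local_minimizer f w -> 0 < b ->
  exists2 x : R, 0 < x < b & f w <= f (w + x *: q).
Proof.
move=> /local_minimizer_ball[e e0 he] b0.
have q0 : 0 <= `|q| by [].
(* The second bound gives [x * |q| < e]; adding [e] to its denominator keeps it positive when [q] is
   zero. *)
exists (Num.min (b / 2) (e / (2 * `|q| + e))).
  rewrite lt_min gt_min !divr_gt0 //; last lra.
  by rewrite ltr_pdivrMr //; apply/andP; split=> //; apply/orP; left; lra.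
apply: he; rewrite normrZ ger0_norm; last first.
  by rewrite le_min !divr_ge0 //; lra.
apply: (@le_lt_trans _ _ (e / (2 * `|q| + e) * `|q|)).
  by apply: ler_wpM2r => //; rewrite ge_min lexx orbT.
rewrite mulrAC ltr_pdivrMr; last lra.
by rewrite ltr_pM2l //; lra.
Qed.

(** No derivative is taken: along minus the gradient [q], the first-order term [- x * N] would
    dominate for small [x] unless [N = |q|^2] vanishes. *)
Lemma local_minimizer_stationary (R : realType) (n : nat) (nu : R)
    (alpha : 'rV[R]_n.+1) (psi w : 'cV[R]_n.+1) :
  local_minimizer (double_well nu alpha psi) w ->
  forall i, multiplier nu alpha (\sum_j w j 0 ^+ 2) i * w i 0 = psi i 0.
Proof.
move=> lmin; set mu := multiplier _ _ _.
pose q : 'cV[R]_n.+1 := \col_i (psi i 0 - mu i * w i 0).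
set N := \sum_i q i 0 ^+ 2.
have N_ge0 : 0 <= N by apply: sumr_ge0 => i _; exact: sqr_ge0.
have [N0|Nneq0] := eqVneq N 0.
  move=> i; have q0 := psumr_eq0P (fun j _ => sqr_ge0 (q j 0)) N0.
  have := q0 i isT.
  by move/eqP; rewrite sqrf_eq0 mxE subr_eq0 => /eqP.
have N0 : 0 < N by rewrite lt0r Nneq0.
set M := \sum_i mu i * q i 0 ^+ 2; set W := \sum_i w i 0 * q i 0.
(* For [0 < x <= 1], [K] bounds the bracket multiplying [x / 2] in the increment, so
   [x < N / (K + 1)] makes the increment negative. *)
pose K := `|M| + (`|W| + N) ^+ 2.
have K0 : 0 <= K by rewrite addr_ge0 ?sqr_ge0.
have b0 : 0 < Num.min 1 (N / (K + 1)).
  by rewrite lt_min ltr01 divr_gt0 //; lra.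
have [x /andP[x0]] := local_minimizer_ray q lmin b0.
rewrite lt_min ltr_pdivlMr; last lra.
move=> /andP[x1 xN]; rewrite -subr_ge0 double_well_increment -/mu.
have -> : \sum_i (mu i * w i 0 - psi i 0) * (x *: q) i 0 = - (x * N).
  rewrite mulr_sumr -sumrN; apply: eq_bigr => i _; rewrite !mxE; ring.
have -> : \sum_i mu i * (x *: q) i 0 ^+ 2 = x ^+ 2 * M.
  rewrite mulr_sumr; apply: eq_bigr => i _; rewrite mxE; ring.
have -> : \sum_i w i 0 * (x *: q) i 0 = x * W.
  rewrite mulr_sumr; apply: eq_bigr => i _; rewrite mxE; ring.
have -> : \sum_i (x *: q) i 0 ^+ 2 = x ^+ 2 * N.
  rewrite mulr_sumr; apply: eq_bigr => i _; rewrite mxE; ring.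
have -> : - (x * N) + 2^-1 * (x ^+ 2 * M + (x * W + 2^-1 * (x ^+ 2 * N)) ^+ 2)
    = x * (2^-1 * x * (M + (W + 2^-1 * x * N) ^+ 2) - N) by field.
rewrite pmulr_rge0 // subr_ge0 => hN.
have : M + (W + 2^-1 * x * N) ^+ 2 <= K.
  apply: lerD; first exact: ler_norm.
  rewrite -[leLHS]real_normK ?num_real //.
  apply: lerXn2r; rewrite ?nnegrE ?addr_ge0 //.
  apply: le_trans (ler_normD _ _) _; rewrite lerD2l ger0_norm; last first.
    by rewrite !mulr_ge0 //; lra.
  by rewrite -[leRHS]mul1r ler_wpM2r //; lra.
move=> hK; exfalso; nra.
Qed.

Lemma stationary_increment (R : realType) (n : nat) (nu : R)
    (alpha : 'rV[R]_n.+1) (psi w d : 'cV[R]_n.+1) :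
  let mu := multiplier nu alpha (\sum_i w i 0 ^+ 2) in
  (forall i, mu i * w i 0 = psi i 0) ->
  double_well nu alpha psi (w + d) - double_well nu alpha psi w =
  2^-1 * (\sum_i mu i * d i 0 ^+ 2
          + (\sum_i w i 0 * d i 0 + 2^-1 * \sum_i d i 0 ^+ 2) ^+ 2).
Proof.
move=> mu stat; rewrite double_well_increment -/mu big1 ?add0r // => i _.
by rewrite stat subrr mul0r.
Qed.

(** As [alpha] is sorted, [mu 0] is the least multiplier; were it nonnegative, every increment from
    [w] would be a sum of nonnegative terms. *)
Lemma nonglobal_multiplier_neg (R : realType) (n : nat) (nu : R)
    (alpha : 'rV[R]_n.+1) (psi w : 'cV[R]_n.+1) :
  (forall i j : 'I_n.+1, (i <= j)%N -> alpha 0 i <= alpha 0 j) ->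
  let mu := multiplier nu alpha (\sum_i w i 0 ^+ 2) in
  (forall i, mu i * w i 0 = psi i 0) ->
  ~ global_minimizer (double_well nu alpha psi) w -> mu 0 < 0.
Proof.
move=> halpha mu stat nglob; rewrite ltNge; apply/negP => mu0; apply: nglob => v.
rewrite -subr_ge0 -[v](subrK w) [v - w + w]addrC stationary_increment //.
rewrite mulr_ge0 // addr_ge0 ?sqr_ge0 // sumr_ge0 // => i _.
rewrite mulr_ge0 ?sqr_ge0 // (le_trans mu0) // lerD2l; exact: halpha.
Qed.

(** If [w 0 0] were zero, a step [x] along the first axis would change the value by x^2/2 (mu_0 +
    x^2/4), which is negative for small [x]. *)
Lemma local_minimizer_coord0_neq0 (R : realType) (n : nat) (nu : R)
    (alpha : 'rV[R]_n.+1) (psi w : 'cV[R]_n.+1) :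
  let mu := multiplier nu alpha (\sum_i w i 0 ^+ 2) in
  local_minimizer (double_well nu alpha psi) w ->
  mu 0 < 0 -> w 0 0 != 0.
Proof.
move=> mu lmin mu0; apply/eqP => w0.
have b0 : 0 < Num.min 1 (- mu 0) by rewrite lt_min ltr01 oppr_gt0.
have [x /andP[x0]] := local_minimizer_ray (delta_mx 0 0) lmin b0.
rewrite lt_min => /andP[x1 xmu].
rewrite -subr_ge0 stationary_increment; last exact: local_minimizer_stationary.
have sumE (F : 'I_n.+1 -> R) : (forall i, i != 0 -> F i = 0) ->
    \sum_i F i = F 0.
  by move=> hF; rewrite (bigD1 ord0) //= big1 ?addr0.
rewrite -/mu !sumE; try by move=> i i0; rewrite !mxE (negPf i0) /= ?(expr0n, mulr0).
rewrite !mxE !eqxx w0 mulr1 mul0r add0r.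
have -> : 2^-1 * (mu 0 * x ^+ 2 + (2^-1 * x ^+ 2) ^+ 2) =
  2^-1 * x ^+ 2 * (mu 0 + 2^-1 ^+ 2 * x ^+ 2) by ring.
rewrite pmulr_rge0; last by rewrite mulr_gt0 ?exprn_gt0.
by move=> h; nra.
Qed.

(* The perturbation is a small rotation in the plane of coordinates 0 and i: it
   preserves the norm, so only the quadratic form of the multipliers remains. *)
Lemma local_minimizer_multiplier_gt0 (R : realType) (n : nat) (nu : R)
    (alpha : 'rV[R]_n.+1) (psi w : 'cV[R]_n.+1) (i : 'I_n.+1) :
  let mu := multiplier nu alpha (\sum_i w i 0 ^+ 2) in
  local_minimizer (double_well nu alpha psi) w ->
  mu 0 < 0 -> i != 0 -> 0 < mu i.
Proof.
move=> mu lmin mu0 i0; rewrite ltNge; apply/negP => mui.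
have w0 := local_minimizer_coord0_neq0 lmin mu0.
have stat := local_minimizer_stationary lmin.
have [e e0 he] := local_minimizer_ball lmin.
set a := w 0 0 in w0; set b := w i 0.
pose A : 'cV[R]_n.+1 := b *: delta_mx 0 0 - a *: delta_mx i 0.
pose B : 'cV[R]_n.+1 := a *: delta_mx 0 0 + b *: delta_mx i 0.
pose M := `|A| + `|B|.
have M0 : 0 <= M by rewrite addr_ge0.
(* [u] is the tangent of half the rotation angle. Its sign is chosen so that [u * a * b >= 0], which
   prevents [b + u * a], hence [d 0 0], from vanishing. *)
have [u [u0 u1 ule uab]] : exists u : R,
    [/\ u != 0, `|u| <= 1, 2 * `|u| * M < e & 0 <= u * (a * b)].
  pose v := Num.min 1 (e / (2 * M + 1 + e)).
  have v0 : 0 < v by rewrite lt_min ltr01 divr_gt0 //; lra.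
  have v1 : v <= 1 by rewrite ge_min lexx.
  have ve : 2 * v * M < e.
    apply: (@le_lt_trans _ _ (2 * (e / (2 * M + 1 + e)) * M)).
      by rewrite ler_wpM2r // ler_wpM2l // ge_min lexx orbT.
    rewrite mulrAC mulrA ltr_pdivrMr; last lra.
    by rewrite mulrC ltr_pM2l //; lra.
  have [ab|/ltW ab] := leP 0 (a * b).
    exists v; rewrite gt_eqF // gtr0_norm //; split=> //.
    by rewrite mulr_ge0 // ltW.
  exists (- v); rewrite oppr_eq0 gt_eqF // normrN gtr0_norm //; split=> //.
  by rewrite mulNr -mulrN mulr_ge0 ?oppr_ge0 // ltW.
(* [x] is the sine of the angle and [x * u] is one minus its cosine, so [w + d] is [w] rotated in
   that plane. *)
pose x := 2 * u / (1 + u ^+ 2).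
have u2 : 0 < 1 + u ^+ 2 by rewrite ltr_pwDl // sqr_ge0.
have x_neq0 : x != 0 by rewrite /x !mulf_neq0 ?invr_eq0 ?(gt_eqF u2) ?pnatr_eq0.
pose d := - x *: (A + u *: B).
have d0E : d 0 0 = - x * (b + u * a).
  by rewrite !mxE !eqxx eq_sym (negPf i0) /=; ring.
have diE : d i 0 = x * (a - u * b).
  by rewrite !mxE !eqxx (negPf i0) /=; ring.
have djE j : j != 0 -> j != i -> d j 0 = 0.
  by move=> j0 ji; rewrite !mxE (negPf j0) (negPf ji) /=; ring.
have normd : `|d| < e.
  apply: le_lt_trans ule; rewrite normrZ normrN; apply: ler_pM => //.
    rewrite normrM normfV (gtr0_norm u2) normrM ger0_norm //.
    by rewrite ler_pdivrMr // ler_peMr // ?lerDl ?sqr_ge0 // mulr_ge0.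
  apply: le_trans (ler_normD _ _) _; rewrite lerD2l normrZ.
  by rewrite -[leRHS]mul1r ler_wpM2r.
have sumE (F : 'I_n.+1 -> R) : (forall j, d j 0 = 0 -> F j = 0) ->
    \sum_j F j = F 0 + F i.
  move=> hF; rewrite (bigD1 ord0) //= (bigD1 i) //= big1 ?addr0 //.
  by move=> j /andP[j0 ji]; apply: hF; exact: djE.
have := he d normd; rewrite -subr_ge0 stationary_increment // -/mu.
rewrite !sumE; try by move=> j ->; rewrite ?expr0n ?mulr0.
rewrite -/a -/b d0E diE.
have -> : a * (- x * (b + u * a)) + b * (x * (a - u * b)) +
   2^-1 * ((- x * (b + u * a)) ^+ 2 + (x * (a - u * b)) ^+ 2) = 0.
  by rewrite /x; field; rewrite gt_eqF.
rewrite expr0n /= addr0 pmulr_rge0 //; apply/negP; rewrite -ltNge.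
apply: ltr_wnDr; first by rewrite mulr_le0_ge0 // sqr_ge0.
rewrite nmulr_rlt0 // exprn_even_gt0 //= mulf_neq0 ?oppr_eq0 //.
apply/eqP => ba0.
have : a * b + u * a ^+ 2 = 0 by rewrite -[RHS](mulr0 a) -ba0; ring.
move=> h; have : u * (a * b) + u ^+ 2 * a ^+ 2 = 0.
  by rewrite -[RHS](mulr0 u) -h; ring.
have : 0 < u ^+ 2 * a ^+ 2 by rewrite mulr_gt0 // exprn_even_gt0.
lra.
Qed.

(* The ray is w + x q with q 0 = w 0 / mu 0 and q i = s * w i / mu i for the
   other i, where s minimises the quadratic form; when the sum below is -1
   that form vanishes on q and the cubic term decides. *)
Lemma local_minimizer_sum_lt (R : realType) (n : nat) (nu : R)
    (alpha : 'rV[R]_n.+1) (psi w : 'cV[R]_n.+1) :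
  let mu := multiplier nu alpha (\sum_i w i 0 ^+ 2) in
  local_minimizer (double_well nu alpha psi) w ->
  mu 0 < 0 -> \sum_i w i 0 ^+ 2 / mu i < -1.
Proof.
move=> mu lmin mu0.
have w0 := local_minimizer_coord0_neq0 lmin mu0.
have stat := local_minimizer_stationary lmin.
have mui i : i != 0 -> 0 < mu i by exact: local_minimizer_multiplier_gt0 lmin mu0.
rewrite ltNge (bigD1 ord0) //=; apply/negP.
set A := _ / mu 0; set B := \sum_(i < n.+1 | _) _ => AB.
have A0 : A < 0.
  by rewrite /A pmulr_rlt0 ?invr_lt0 // exprn_even_gt0.
have B0 : 0 <= B.
  by apply: sumr_ge0 => i /mui hi; rewrite divr_ge0 ?sqr_ge0 // ltW.
have B1 : 0 < 1 + B by lra.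
pose s := - A / (1 + B).
pose q : 'cV[R]_n.+1 := \col_i ((if i == 0 then 1 else s) * (w i 0 / mu i)).
pose m := A / (1 + B).
have m0 : m < 0 by rewrite /m pmulr_llt0 ?invr_gt0.
have wq : \sum_i w i 0 * q i 0 = m.
  rewrite (bigD1 ord0) //= mxE eqxx.
  have -> : \sum_(i < n.+1 | i != ord0) w i 0 * q i 0 = s * B.
    rewrite mulr_sumr; apply: eq_bigr => i i0; rewrite mxE (negPf i0); ring.
  rewrite mul1r mulrA -expr2 -/A /m /s; field; rewrite gt_eqF //; lra.
(* The gap equals -A (1 + A + B) / (1 + B), and 1 + A + B is nonnegative by the negated goal
   [AB]. *)
have muq : \sum_i mu i * q i 0 ^+ 2 <= - m ^+ 2.
  rewrite (bigD1 ord0) //= mxE eqxx.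
  have -> : \sum_(i < n.+1 | i != ord0) mu i * q i 0 ^+ 2 = s ^+ 2 * B.
    rewrite mulr_sumr; apply: eq_bigr => i i0; rewrite mxE (negPf i0).
    by field; rewrite gt_eqF // mui.
  have -> : mu 0 * (1 * (w ord0 0 / mu ord0)) ^+ 2 = A.
    by rewrite /A; field; rewrite lt_eqF.
  rewrite -subr_ge0.
  have -> : - m ^+ 2 - (A + s ^+ 2 * B) = - A * (1 + B)^-1 * (1 + A + B).
    by rewrite /m /s; field; rewrite gt_eqF //; lra.
  rewrite mulr_ge0 ?mulr_ge0 ?invr_ge0 //; lra.
set P := \sum_i q i 0 ^+ 2.
have P0 : 0 < P.
  rewrite /P (bigD1 ord0) //= ltr_pwDl //.
    rewrite exprn_even_gt0 //= mxE eqxx mul1r mulf_neq0 // invr_eq0 lt_eqF //.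
  by apply: sumr_ge0 => i _; exact: sqr_ge0.
(* With [x * P < - m], the number m + xP/2 lies strictly between [m] and 0, so its square is below
   m^2 and the increment is negative even if [muq] is an equality. *)
have b0 : 0 < - m / P by rewrite divr_gt0 // oppr_gt0.
have [x /andP[x0]] := local_minimizer_ray q lmin b0.
rewrite ltr_pdivlMr // => xP; rewrite -subr_ge0 stationary_increment // -/mu.
have -> : \sum_i mu i * (x *: q) i 0 ^+ 2 = x ^+ 2 * \sum_i mu i * q i 0 ^+ 2.
  rewrite mulr_sumr; apply: eq_bigr => i _; rewrite mxE; ring.
have -> : \sum_i w i 0 * (x *: q) i 0 = x * m.
  rewrite -wq mulr_sumr; apply: eq_bigr => i _; rewrite mxE; ring.
have -> : \sum_i (x *: q) i 0 ^+ 2 = x ^+ 2 * P.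
  rewrite mulr_sumr; apply: eq_bigr => i _; rewrite mxE; ring.
set M := \sum_i _ in muq *.
have -> : 2^-1 * (x ^+ 2 * M + (x * m + 2^-1 * (x ^+ 2 * P)) ^+ 2) =
  2^-1 * x ^+ 2 * (M + (m + 2^-1 * x * P) ^+ 2) by field.
rewrite pmulr_rge0; last by rewrite mulr_gt0 ?exprn_gt0.
have xP0 : 0 < x * P by rewrite mulr_gt0.
have -> : 2^-1 * x * P = 2^-1 * (x * P) by rewrite mulrA.
by move=> h; nra.
Qed.

(** * The secular function on its interval *)

(** Sorting lets index 1 decide the sign for all later indices; in dimension 1 the last condition is
    vacuous, in agreement with the convention. *)
Lemma mem_secular_interval (R : realType) (n : nat) (nu : R)
    (alpha : 'rV[R]_n.+1) (t : R) :
  (forall i j : 'I_n.+1, (i <= j)%N -> alpha 0 i <= alpha 0 j) ->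
  t \in secular_interval nu alpha <->
  [/\ 0 < t, multiplier nu alpha t 0 < 0 &
      forall i, i != 0 -> 0 < multiplier nu alpha t i].
Proof.
move=> halpha; rewrite /secular_interval in_itv /=; split.
  move=> /andP[lt_t t_lt]; rewrite /multiplier.
  split; last 2 first.
  - by lra.
  - move=> i i0; move: lt_t; rewrite /secular_left.
    case: insubP => [j _ j1|/negP[]].
      rewrite gt_max => /andP[tj _].
      have : alpha 0 j <= alpha 0 i by apply: halpha; rewrite j1 lt0n.
      by move=> h; lra.
    by apply: leq_trans (ltn_ord i); rewrite ltnS lt0n.
  apply: le_lt_trans lt_t; rewrite /secular_left.
  by case: insubP => // j _ _; rewrite le_max lexx orbT.
rewrite /multiplier => -[t0 h0 hi]; apply/andP; split; last lra.
rewrite /secular_left; case: insubP => // j _ j1; rewrite gt_max t0 andbT.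
have /hi h : j != 0 by rewrite -val_eqE /= j1.
lra.
Qed.

Lemma secular_denomE (R : realType) (n : nat) (nu : R)
    (alpha : 'rV[R]_n.+1) (t : R) i :
  t - 2 * nu + 2 * alpha 0 i = 2 * multiplier nu alpha t i.
Proof. by rewrite /multiplier; field. Qed.

Lemma secular_pointE (R : realType) (n : nat) (nu : R)
    (alpha : 'rV[R]_n.+1) (psi : 'cV[R]_n.+1) (t : R) i :
  secular_point nu alpha psi t i 0 = psi i 0 / multiplier nu alpha t i.
Proof.
by rewrite mxE secular_denomE -mulf_div divff ?mul1r ?pnatr_eq0.
Qed.

(** Thus a root is exactly a [t] equal to the squared norm of its own secular point, which is what
    makes that point stationary. *)
Lemma secularE (R : realType) (n : nat) (nu : R)
    (alpha : 'rV[R]_n.+1) (psi : 'cV[R]_n.+1) (t : R) :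
  secular nu alpha psi t =
  \sum_i secular_point nu alpha psi t i 0 ^+ 2 - t.
Proof.
congr (_ - _); apply: eq_bigr => i _; rewrite mxE expr_div_n exprMn.
by congr (_ * _ / _); rewrite -natrX.
Qed.

Lemma derive_secular (R : realType) (n : nat) (nu : R)
    (alpha : 'rV[R]_n.+1) (psi : 'cV[R]_n.+1) (t : R) :
  let mu := multiplier nu alpha t in
  (forall i, mu i != 0) ->
  (secular nu alpha psi)^`()%classic t =
  - (\sum_i secular_point nu alpha psi t i 0 ^+ 2 / mu i) - 1.
Proof.
move=> mu mu0.
(* [k] and [h] are shaped as a shift and as a scaled power of an inverse so that the differentiation
   rules apply structurally. *)
pose k i (x : R) : R := x + (- (2 * nu) + 2 * alpha 0 i).
pose h i : R -> R := (4 * psi i 0 ^+ 2) *: ((fun x => (k i x)^-1) ^+ 2).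
have kE i x : k i x = 2 * multiplier nu alpha x i.
  by rewrite -secular_denomE /k addrA.
have dh i : is_derive t 1 (h i)
    (- (secular_point nu alpha psi t i 0 ^+ 2 / mu i)).
  have k0 : k i t != 0 by rewrite kE mulf_neq0 ?pnatr_eq0 ?mu0.
  have dk : is_derive t 1 (k i) 1.
    by apply: is_derive_eq; rewrite addr0.
  have dV := is_deriveV k0 dk.
  apply: is_derive_eq; rewrite /= secular_pointE -/mu kE -/mu.
  by rewrite /GRing.scale /=; field; rewrite mu0.
have -> : secular nu alpha psi = (\sum_i h i) - id.
  apply/funext => x; rewrite /secular !fctE fct_sumE; congr (_ - _).
  apply: eq_bigr => i _; rewrite secular_denomE -kE /h.
  by rewrite /GRing.scale /= -exprVn.
have ds := is_derive_sum dh.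
by rewrite derive1E derive_val sumrN.
Qed.

(** Convexity in tangent-line form: each summand is convex on either side of its pole, and the
    hypothesis puts [t] and [u] on the same side of every pole. *)
Lemma secular_tangent (R : realType) (n : nat) (nu : R)
    (alpha : 'rV[R]_n.+1) (psi : 'cV[R]_n.+1) (t u : R) :
  (forall i, 0 < multiplier nu alpha t i * multiplier nu alpha u i) ->
  secular nu alpha psi t
  + (secular nu alpha psi)^`()%classic t * (u - t) <= secular nu alpha psi u.
Proof.
move=> tu.
have mu0 i : multiplier nu alpha t i != 0.
  by apply: contraTneq (tu i) => ->; rewrite mul0r ltxx.
rewrite derive_secular // !secularE -subr_ge0.
have -> : forall a b c : R, a - u - (b - t + (- c - 1) * (u - t)) =
  a - b + (u - t) * c by move=> a b c; ring.
rewrite -sumrN mulr_sumr -!big_split sumr_ge0 //= => i _.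
rewrite !secular_pointE; move: (tu i).
have -> : u - t = 2 * (multiplier nu alpha u i - multiplier nu alpha t i).
  by rewrite /multiplier; field.
set x := multiplier _ _ _ _; set y := multiplier _ _ _ _ => xy.
have x0 : x != 0 by apply: contraTneq xy => ->; rewrite mul0r ltxx.
have y0 : y != 0 by apply: contraTneq xy => ->; rewrite mulr0 ltxx.
(* The tangent gap of one summand is a square times 2xy + x^2, which is positive because xy is. *)
have -> : (psi i 0 / y) ^+ 2 - (psi i 0 / x) ^+ 2
    + 2 * (y - x) * ((psi i 0 / x) ^+ 2 / x) =
    (psi i 0 * (y - x) / (x ^+ 2 * y)) ^+ 2 * (2 * (x * y) + x ^+ 2).
  by field; rewrite x0 y0.
by rewrite mulr_ge0 ?sqr_ge0 // addr_ge0 ?sqr_ge0 // mulr_ge0 // ltW.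
Qed.

(** The tangent at [t], evaluated at the root [u], forces [u <= t] since its slope is positive;
    exchanging the roles gives equality. *)
Lemma secular_root_unique (R : realType) (n : nat) (nu : R)
    (alpha : 'rV[R]_n.+1) (psi : 'cV[R]_n.+1) (t u : R) :
  (forall i j : 'I_n.+1, (i <= j)%N -> alpha 0 i <= alpha 0 j) ->
  t \in secular_interval nu alpha -> u \in secular_interval nu alpha ->
  secular nu alpha psi t = 0 -> secular nu alpha psi u = 0 ->
  0 < (secular nu alpha psi)^`()%classic t ->
  0 < (secular nu alpha psi)^`()%classic u ->
  t = u.
Proof.
move=> halpha /(mem_secular_interval _ _ halpha)[_ t0 ti].
move=> /(mem_secular_interval _ _ halpha)[_ u0 ui] ht hu dt du.
have tu i : 0 < multiplier nu alpha t i * multiplier nu alpha u i.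
  have [->|i0] := eqVneq i 0; first by rewrite nmulr_rgt0.
  by rewrite mulr_gt0 ?ti ?ui.
have := secular_tangent psi tu; rewrite ht hu add0r pmulr_rle0 // => h1.
have := @secular_tangent _ _ nu alpha psi u t.
rewrite ht hu add0r pmulr_rle0 // => h2.
apply/eqP; rewrite eq_le; apply/andP; split; rewrite -subr_le0 //.
by apply: h2 => i; rewrite mulrC.
Qed.

(** * Sufficiency of a root with positive derivative *)

(* Minimising over the coordinates i != 0 for fixed d 0 gives the completion of
   squares with parameter s in the proof. *)
Lemma quadratic_form_ge0 (R : realType) (n : nat) (mu v d : 'I_n.+1 -> R) :
  mu 0 < 0 -> (forall i, i != 0 -> 0 < mu i) ->
  \sum_i v i ^+ 2 / mu i <= -1 ->
  0 <= \sum_i mu i * d i ^+ 2 + (\sum_i v i * d i) ^+ 2.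
Proof.
move=> mu0 mui.
have sumE (F : 'I_n.+1 -> R) : \sum_i F i = F 0 + \sum_(i < n.+1 | i != 0) F i.
  by rewrite (bigD1 ord0).
rewrite !sumE.
set B := \sum_(i < n.+1 | _) v i ^+ 2 / _.
set S := \sum_(i < n.+1 | _) mu i * _.
set V := \sum_(i < n.+1 | _) v i * _ => hB.
have B0 : 0 <= B.
  by apply: sumr_ge0 => i /mui hi; rewrite divr_ge0 ?sqr_ge0 // ltW.
have B1 : 0 < 1 + B by lra.
pose U := v 0 * d 0.
pose s := U / (1 + B).
have SV : 0 <= S + 2 * s * V + s ^+ 2 * B.
  rewrite !mulr_sumr -!big_split /=; apply: sumr_ge0 => i /mui hi.
  have -> : mu i * d i ^+ 2 + 2 * s * (v i * d i) + s ^+ 2 * (v i ^+ 2 / mu i)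
    = mu i * (d i + s * v i / mu i) ^+ 2 by field; rewrite gt_eqF.
  by rewrite mulr_ge0 ?sqr_ge0 // ltW.
(* The bound on the sum of v_i^2 / mu_i enters here: it says that v_0^2 / mu_0 + B + 1 is
   nonpositive, and the quantity is a nonnegative multiple of its opposite. *)
have d0 : 0 <= mu 0 * d 0 ^+ 2 + s * U.
  have : 0 <= - mu 0 * d 0 ^+ 2 * (1 + B)^-1 * - (v 0 ^+ 2 / mu 0 + B + 1).
    apply: mulr_ge0; last lra.
    by rewrite mulr_ge0 ?invr_ge0 ?(ltW B1) // mulr_ge0 ?sqr_ge0 // oppr_ge0 ltW.
  congr (_ <= _); rewrite /s /U; field.
  by rewrite (gt_eqF B1) (lt_eqF mu0).
have sU : s * U - s ^+ 2 * (1 + B) = 0.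
  by rewrite /s; field; rewrite gt_eqF //; lra.
have -> : mu 0 * d 0 ^+ 2 + S + (v 0 * d 0 + V) ^+ 2 =
    (mu 0 * d 0 ^+ 2 + s * U) + (S + 2 * s * V + s ^+ 2 * B)
    + (U + V - s) ^+ 2 + (s * U - s ^+ 2 * (1 + B)) by rewrite /U; ring.
by rewrite sU addr0 addr_ge0 ?sqr_ge0 // addr_ge0.
Qed.

Lemma secular_point_local_nonglobal (R : realType) (n : nat) (nu : R)
    (alpha : 'rV[R]_n.+1) (psi : 'cV[R]_n.+1) (t : R) :
  (forall i j : 'I_n.+1, (i <= j)%N -> alpha 0 i <= alpha 0 j) ->
  t \in secular_interval nu alpha ->
  secular nu alpha psi t = 0 -> 0 < (secular nu alpha psi)^`()%classic t ->
  local_nonglobal_minimizer (double_well nu alpha psi)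
    (secular_point nu alpha psi t).
Proof.
move=> halpha /(mem_secular_interval _ _ halpha)[t0 mu0 mui].
set mu := multiplier nu alpha t in mu0 mui.
have mu_neq0 i : mu i != 0.
  by have [->|/mui/gt_eqF->//] := eqVneq i 0; rewrite lt_eqF.
rewrite derive_secular // -/mu secularE => /eqP; rewrite subr_eq0 => /eqP.
have wE i : mu i * secular_point nu alpha psi t i 0 = psi i 0.
  by rewrite secular_pointE -/mu mulrC divfK.
move: (secular_point nu alpha psi t) wE => w wE wt hQ.
have stat i : multiplier nu alpha (\sum_j w j 0 ^+ 2) i * w i 0 = psi i 0.
  by rewrite wt wE.
have Q1 : \sum_i w i 0 ^+ 2 / mu i < -1 by lra.
split.
  (* The strict inequality is needed at the midpoint of [w] and [v], where w.d + |d|^2/2 becomes a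
     pairing with d = v - w; continuity carries it from [w] to all nearby [v]. *)
  have cont : continuous (fun v : 'cV[R]_n.+1 =>
      \sum_i (2^-1 * (w i 0 + v i 0)) ^+ 2 / mu i).
    apply: continuous_big => [|i _]; first exact: add_continuous.
    have mid : continuous (fun v : 'cV[R]_n.+1 => 2^-1 * (w i 0 + v i 0)).
      move=> u; apply: (@cvgMl_tmp _ _ (nbhs u)).
      by apply: cvgD; [exact: cvg_cst|exact: coord_continuous].
    move=> u; apply: (@cvgMr_tmp _ _ (nbhs u)).
    exact: continuous_comp (mid u) (@exprn_continuous R 2 _).
  have Qmid : \sum_i (2^-1 * (w i 0 + w i 0)) ^+ 2 / mu i < -1.
    rewrite (eq_bigr (fun i => w i 0 ^+ 2 / mu i)) // => i _.
    by congr (_ ^+ 2 / _); field.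
  rewrite /local_minimizer; near=> v.
  have hv : \sum_i (2^-1 * (w i 0 + v i 0)) ^+ 2 / mu i <= -1.
    by near: v; exact: cvgr_le (cont w) _ Qmid.
  rewrite -subr_ge0 -[v](subrK w) [v - w + w]addrC stationary_increment // wt.
  rewrite mulr_ge0 //.
  have -> : \sum_i w i 0 * (v - w) i 0 + 2^-1 * \sum_i (v - w) i 0 ^+ 2 =
      \sum_i 2^-1 * (w i 0 + v i 0) * (v - w) i 0.
    rewrite mulr_sumr -big_split /=.
    by apply: eq_bigr => i _; rewrite !mxE; field.
  exact: quadratic_form_ge0 hv.
(* Flipping the sign of coordinate 0 preserves the norm, so only 2 mu_0 w_0^2 remains of the
   increment. *)
move=> /(_ (w - (2 * w 0 0) *: delta_mx 0 0)); apply/negP; rewrite -ltNge.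
have w0 : w 0 0 != 0.
  apply: contraTneq Q1 => w0; rewrite -leNgt; apply: (@le_trans _ _ 0) => //.
  rewrite (bigD1 ord0) //= w0 expr0n mul0r add0r; apply: sumr_ge0 => i /mui hi.
  by rewrite divr_ge0 ?sqr_ge0 // ltW.
have sumE (F : 'I_n.+1 -> R) : (forall i, i != 0 -> F i = 0) ->
    \sum_i F i = F 0.
  by move=> hF; rewrite (bigD1 ord0) //= big1 ?addr0.
rewrite -subr_lt0 stationary_increment // wt -/mu !sumE; last 3 first.
- by move=> i i0; rewrite !mxE (negPf i0) /= !(mulr0, oppr0, expr0n).
- by move=> i i0; rewrite !mxE (negPf i0) /= !(mulr0, oppr0, expr0n).
- by move=> i i0; rewrite !mxE (negPf i0) /= !(mulr0, oppr0, expr0n).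
rewrite !mxE !eqxx mulr1.
have -> : w 0 0 * - (2 * w 0 0) + 2^-1 * (- (2 * w 0 0)) ^+ 2 = 0 by field.
rewrite expr0n addr0 pmulr_rlt0 // nmulr_rlt0 //.
by rewrite exprn_even_gt0 //= oppr_eq0 mulf_neq0 ?pnatr_eq0.
Unshelve. all: by end_near.
Qed.

(** * Correspondence between minimizers and roots *)

Lemma local_nonglobal_secular (R : realType) (n : nat) (nu : R)
    (alpha : 'rV[R]_n.+1) (psi w : 'cV[R]_n.+1) :
  (forall i j : 'I_n.+1, (i <= j)%N -> alpha 0 i <= alpha 0 j) ->
  local_nonglobal_minimizer (double_well nu alpha psi) w ->
  let t := \sum_i w i 0 ^+ 2 in
  [/\ t \in secular_interval nu alpha, secular nu alpha psi t = 0,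
      0 < (secular nu alpha psi)^`()%classic t &
      w = secular_point nu alpha psi t].
Proof.
move=> halpha [lmin nglob] t.
have stat := local_minimizer_stationary lmin.
have mu0 := nonglobal_multiplier_neg halpha stat nglob.
have mui i := @local_minimizer_multiplier_gt0 _ _ _ _ _ _ i lmin mu0.
have w0 := local_minimizer_coord0_neq0 lmin mu0.
have := local_minimizer_sum_lt lmin mu0.
rewrite -/t in stat mu0 mui * => Q1.
have mu_neq0 i : multiplier nu alpha t i != 0.
  by have [->|/mui/gt_eqF->//] := eqVneq i 0; rewrite lt_eqF.
have wE : w = secular_point nu alpha psi t.
  apply/matrixP => i j; rewrite (ord1 j) secular_pointE -stat mulrC mulKf //.
split=> //.
- apply/mem_secular_interval => //; split=> //.
  rewrite /t (bigD1 ord0) //= ltr_pwDl ?exprn_even_gt0 //.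
  by apply: sumr_ge0 => i _; exact: sqr_ge0.
- by rewrite secularE -wE subrr.
- by rewrite derive_secular // -wE; lra.
Qed.

Theorem theorem2 (R : realType) (n : nat) (nu : R)
    (alpha : 'rV[R]_n.+1) (psi : 'cV[R]_n.+1)
    (halpha : forall i j : 'I_n.+1, (i <= j)%N -> alpha 0 i <= alpha 0 j) :
  ((exists w : 'cV[R]_n.+1,
      local_nonglobal_minimizer (double_well nu alpha psi) w) <->
   (exists t : R,
      [/\ t \in secular_interval nu alpha,
          secular nu alpha psi t = 0 &
          0 < (secular nu alpha psi)^`()%classic t])) /\
  (forall t : R,
      t \in secular_interval nu alpha ->
      secular nu alpha psi t = 0 ->
      0 < (secular nu alpha psi)^`()%classic t ->
      forall w : 'cV[R]_n.+1,
        local_nonglobal_minimizer (double_well nu alpha psi) w <->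
        w = secular_point nu alpha psi t).
Proof.
split; [split|].
- by move=> [w /(local_nonglobal_secular halpha)[*]]; exists (\sum_i w i 0 ^+ 2).
- move=> [t [tI ht dt]]; exists (secular_point nu alpha psi t).
  exact: secular_point_local_nonglobal.
- move=> t tI ht dt w; split=> [|->]; last exact: secular_point_local_nonglobal.
  (* A minimizer [w] comes with its own root |w|^2; uniqueness of the root identifies it with the
     given [t]. *)
  move=> /(local_nonglobal_secular halpha)[uI hu du {1}->].
  by congr secular_point; exact: secular_root_unique du dt.
Qed.
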